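(* Let $\mathcal G$ be a periodic graph with fundamental graph $G_*=(\mathcal V_*,\mathcal E_* )$, $\nu=\#\mathcal V_*$. Consider the magnetic Schrödinger operator $H_\alpha=\Delta_\alpha+Q$ and the Schrödinger operator $H_0=\Delta_0+Q$ without a magnetic field, let $(\mathfrak m,\phi)\in\mathscr F(\kappa)\times\mathscr F(\alpha)$ be minimal forms on $G_*$, and let $\widetilde\phi$ be the associated 1-form. Then the spectral bands $$\sigma_{\alpha,n}=\sigma_n(H_\alpha)=[\lambda_{\alpha,n}^-,\lambda_{\alpha,n}^+],\qquad \sigma_{0,n}=\sigma_n(H_0)=[\lambda_{0,n}^-,\lambda_{0,n}^+],\qquad n=1,\ldots,\nu,$$ satisfy $$\Lambda_1\le\lambda^{\pm}_{\alpha,n}-\lambda^{\pm}_{0,n}\le\Lambda_\nu,\qquad \big||\sigma_{\alpha,n}|-|\sigma_{0,n}|\big|\le\Lambda_\nu-\Lambda_1,$$ where $$\Lambda_1=\min_{\vartheta\in\mathbb T^d}\lambda_1(X_{\mathfrak m,\widetilde\phi}(\vartheta)),\qquad \Lambda_\nu=\max_{\vartheta\in\mathbb T^d}\lambda_\nu(X_{\mathfrak m,\widetilde\phi}(\vartheta)),\qquad X_{\mathfrak m,\widetilde\phi}(\cdot)=\Delta_{\mathfrak m,\widetilde\phi}(\cdot)-\Delta_{\mathfrak m,0}(\cdot),$$ and $\lambda_1(X)\le\dots\le\lambda_\nu(X)$ denote the eigenvalues of a self-adjoint operator $X$ on $\ell^2(\mathcal V_* )$. Moreover, $$\max\{|\Lambda_1|,|\Lambda_\nu|\}\le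 C_{\widetilde\phi},\qquad \Lambda_\nu-\Lambda_1\le2C_{\widetilde\phi},\qquad C_{\widetilde\phi}=2\max_{v\in\mathcal V_*}\sum_{\mathbf e=(v,u)\in\operatorname{supp}\widetilde\phi}\Big|\sin\frac{\widetilde\phi(\mathbf e)}2\Big|.$$
   Context: Periodic graphs. $\Gamma\subset\mathbb R^d$ is a lattice of rank $d$ with basis $a_1,\ldots,a_d$. For $x=\sum_s t_sa_s\in\mathbb R^d$ write $x_{\mathbb A}=(t_1,\ldots,t_d)$. $\mathcal G=(\mathcal V,\mathcal E)$ is a connected infinite locally finite graph (loops and multiple edges allowed) embedded in $\mathbb R^d$, with $\mathcal G+a=\mathcal G$ for all $a\in\Gamma$ and finite quotient graph $G_*=\mathcal G/\Gamma=(\mathcal V_*,\mathcal E_* )$, the fundamental graph. $\mathcal A$ and $\mathcal A_*$ are the sets of oriented edges of $\mathcal G$ and $G_*$ (each unoriented edge has two orientations); $\underline{\mathbf e}$ is the inverse of $\mathbf e$; $(v,u)$ denotes an oriented edge from $v$ to $u$. The degree $\varkappa_v$ is the number of oriented edges starting at $v$ (a loop contributes 2). Operators. A magnetic potential is $\alpha:\mathcal A\to\mathbb R$ with $\alpha(\underline{\mathbf e})=-\alpha(\mathbf e)$, $\alpha(\mathbf e+a)=\alpha(\mathbf e)$ for $a\in\Gamma$; $Q:\mathcal V\to\mathbb R$ is $\Gamma$-periodic and acts by multiplication. On $\ell^2(\mathcal V)$, $(\Delta_\alpha f)(v)=\sum_{\mathbf e=(v,u)\in\mathcal A}(f(v)-e^{i\alpha(\mathbf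 e)}f(u))$ and $H_\alpha=\Delta_\alpha+Q$. Forms. A 1-form on a finite connected graph with oriented edge set $A$ is $\mathfrak b:A\to\mathbb R^n$ with $\mathfrak b(\underline{\mathbf e})=-\mathfrak b(\mathbf e)$. The flux through a cycle $\mathbf c$ is $\Phi_{\mathfrak b}(\mathbf c)=\sum_{\mathbf e\in\mathbf c}\mathfrak b(\mathbf e)$. $\mathscr F(\mathbf x)$ is the set of 1-forms $\mathfrak b$ with $\Phi_{\mathfrak b}=\Phi_{\mathbf x}$ on the cycle space. A form $\mathfrak m\in\mathscr F(\mathbf x)$ is minimal if $\#\operatorname{supp}\mathfrak m\le\#\operatorname{supp}\mathfrak b$ for all $\mathfrak b\in\mathscr F(\mathbf x)$. On $G_*$: the coordinate form $\kappa:\mathcal A_*\to\mathbb R^d$ is induced by $\kappa(\mathbf e)=v_{\mathbb A}-u_{\mathbb A}$ for $\mathbf e=(u,v)\in\mathcal A$; the magnetic form $\alpha:\mathcal A_*\to\mathbb R$ is induced by the potential $\alpha$. For the magnetic form fluxes are taken modulo $2\pi$: $\mathscr F(\alpha)$ is the set of real 1-forms on $G_*$ with the same fluxes as $\alpha$ modulo $2\pi$. A minimal $\mathfrak m\in\mathscr F(\kappa)$ has values in $\mathbb Z^d$ generating $\mathbb Z^d$. Fiber operators and bands. For a real 1-form $\psi$ on $G_*$ and $\vartheta\in\mathbb T^d=\mathbb R^d/(2\pi\mathbb Z)^d$, $(\Delta_{\mathfrak m,\psi}(\vartheta)f)(v)=\varkappa_vf(v)-\sum_{\mathbf e=(v,u)\in\mathcal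 A_*}e^{i(\psi(\mathbf e)+\langle\mathfrak m(\mathbf e),\vartheta\rangle)}f(u)$ on $\ell^2(\mathcal V_* )$. The eigenvalues $\lambda_{\alpha,1}(\vartheta)\le\ldots\le\lambda_{\alpha,\nu}(\vartheta)$ of $\Delta_{\mathfrak m,\phi}(\vartheta)+Q$ (with multiplicity) define the bands $\sigma_n(H_\alpha)=\lambda_{\alpha,n}(\mathbb T^d)=[\lambda_{\alpha,n}^-,\lambda_{\alpha,n}^+]$; for $\alpha=0$ one takes $\phi=0$, giving $\sigma_n(H_0)=[\lambda_{0,n}^-,\lambda_{0,n}^+]$. The form $\widetilde\phi$. Choose edges $\mathbf e_1,\ldots,\mathbf e_d\in\operatorname{supp}\mathfrak m$ with $\mathfrak m(\mathbf e_1),\ldots,\mathfrak m(\mathbf e_d)$ linearly independent, set $\mathcal B=\{\mathbf e_1,\ldots,\mathbf e_d,\underline{\mathbf e}_1,\ldots,\underline{\mathbf e}_d\}$, and let $\vartheta_0$ solve $\phi(\mathbf e_s)+\langle\mathfrak m(\mathbf e_s),\vartheta_0\rangle=0$, $s=1,\ldots,d$ (with $\vartheta_0\in\mathbb R^d$ a representative of a point of $\mathbb T^d$). Then $\widetilde\phi(\mathbf e)=\phi(\mathbf e)+\langle\mathfrak m(\mathbf e),\vartheta_0\rangle$ if $\mathbf e\in(\operatorname{supp}\mathfrak m\cup\operatorname{supp}\phi)\setminus\mathcal B$, and $\widetilde\phi(\mathbf e)=0$ otherwise. *)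

(* Defs.v *)
From HB Require Import structures.
From mathcomp Require Import all_boot all_order all_algebra.
From mathcomp Require Import complex.
From mathcomp Require Import all_classical all_reals all_analysis.

Set Implicit Arguments.
Unset Strict Implicit.
Unset Printing Implicit Defensive.

Import Order.TTheory GRing.Theory Num.Theory.

Local Open Scope classical_set_scope.
Local Open Scope ring_scope.

(* Multigraphs given by their oriented edges: V is the type of vertices, A the
   type of oriented edges and [rev] the orientation reversal.  An unoriented
   edge is a pair {e, rev e}; a loop has two distinct orientations. *)
Record graph (V A : Type) := Graph {
  src : A -> V;
  tgt : A -> V;
  rev : A -> A;
  revK : involutive rev;
  rev_neq : forall e, rev e <> e;
  src_rev : forall e, src (rev e) = tgt e
}.

Section Graphs.
Context {V A : Type}.
Variable G : graph V A.

Fixpoint walk (u : V) (p : seq A) (v : V) : Prop :=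
  if p is e :: p' then src G e = u /\ walk (tgt G e) p' v else u = v.

Definition graph_connected : Prop := forall u v, exists p, walk u p v.

Definition locally_finite : Prop :=
  forall v, finite_set [set e | src G e = v].

Definition is_cycle (c : seq A) : Prop := exists v, walk v c v.

Definition one_form {U : zmodType} (b : A -> U) : Prop :=
  forall e, b (rev G e) = - b e.

End Graphs.

(* The rows of [lat_basis] are the basis a_1, ..., a_d of the lattice.
   [vtrans n] and [etrans n] are the translations of vertices and of oriented
   edges by the lattice vector n_1 a_1 + ... + n_d a_d.  A vertex is determined
   by its position in R^d; because of multiple edges an edge is not determined
   by its end points, so that the translations of edges are part of the data. *)
Record periodic_graph (R : realType) (d : nat) (V A : Type) := PeriodicGraph {
  pg_graph :> graph V A;
  pg_infinite : infinite_set [set: V];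
  pg_locally_finite : locally_finite pg_graph;
  pg_connected : graph_connected pg_graph;
  lat_basis : 'M[R]_d;
  lat_basis_unit : lat_basis \in unitmx;
  pos : V -> 'rV[R]_d;
  pos_inj : injective pos;
  vtrans : 'rV[int]_d -> V -> V;
  etrans : 'rV[int]_d -> A -> A;
  pos_vtrans : forall n v,
    pos (vtrans n v) = pos v + map_mx intr n *m lat_basis;
  etrans0 : forall e, etrans 0 e = e;
  etransD : forall n n' e, etrans (n + n') e = etrans n (etrans n' e);
  src_etrans : forall n e,
    src pg_graph (etrans n e) = vtrans n (src pg_graph e);
  rev_etrans : forall n e,
    rev pg_graph (etrans n e) = etrans n (rev pg_graph e)
}.

(* A finite graph together with a projection exhibiting it as the quotient of
   the periodic graph P by the lattice: the fibres are exactly the orbits. *)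
Record fundamental_graph (R : realType) (d : nat) (V A : Type)
    (P : periodic_graph R d V A) (Vs As : finType) := FundamentalGraph {
  fg_graph :> graph Vs As;
  vproj : V -> Vs;
  eproj : A -> As;
  vproj_surj : forall x, exists v, vproj v = x;
  eproj_surj : forall x, exists e, eproj e = x;
  vprojP : forall u v, vproj u = vproj v <-> exists n, v = vtrans P n u;
  eprojP : forall e f, eproj e = eproj f <-> exists n, f = etrans P n e;
  src_eproj : forall e, src fg_graph (eproj e) = vproj (src P e);
  rev_eproj : forall e, rev fg_graph (eproj e) = eproj (rev P e)
}.

(* The function induced on a quotient, evaluated at a chosen representative.
   It is only used for lattice-invariant f, for which the choice is
   irrelevant. *)
Definition induced {T S U : Type} (p : T -> S)
    (p_surj : forall x, exists t, p t = x) (f : T -> U) (x : S) : U :=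
  f (sval (cid (p_surj x))).

Section PeriodicData.
Context {R : realType} {d : nat} {V A : Type}.
Variable P : periodic_graph R d V A.

(* the coordinates t of x = t_1 a_1 + ... + t_d a_d *)
Definition lat_coord (x : 'rV[R]_d) : 'rV[R]_d := x *m invmx (lat_basis P).

Definition magnetic_potential (alpha : A -> R) : Prop :=
  one_form P alpha /\ forall n e, alpha (etrans P n e) = alpha e.

Definition electric_potential (Q : V -> R) : Prop :=
  forall n v, Q (vtrans P n v) = Q v.

Context {Vs As : finType}.
Variable G : fundamental_graph P Vs As.

Definition coordinate_form : As -> 'rV[R]_d :=
  induced (eproj_surj G)
    (fun e => lat_coord (pos P (tgt P e)) - lat_coord (pos P (src P e))).

Definition magnetic_form (alpha : A -> R) : As -> R :=
  induced (eproj_surj G) alpha.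

Definition quotient_potential (Q : V -> R) : Vs -> R :=
  induced (vproj_surj G) Q.

End PeriodicData.

Section Forms.
Context {R : realType} {Vs As : finType}.
Variable G : graph Vs As.

Definition flux {U : zmodType} (b : As -> U) (c : seq As) : U :=
  \sum_(e <- c) b e.

Definition supp {U : zmodType} (b : As -> U) : pred As := [pred e | b e != 0].

Definition forms_with_flux {U : zmodType} (x : As -> U) : set (As -> U) :=
  [set b | one_form G b /\ forall c, is_cycle G c -> flux b c = flux x c].

Definition forms_with_flux_mod2pi (x : As -> R) : set (As -> R) :=
  [set b | one_form G b /\ forall c, is_cycle G c ->
             exists k : int, flux b c = flux x c + 2 * pi * k%:~R].

Definition minimal_form {U : zmodType} (F : set (As -> U)) (m : As -> U) :=
  F m /\ forall b, F b -> (#|supp m| <= #|supp b|)%N.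

End Forms.

Definition dotp {R : realType} {d : nat} (x y : 'rV[R]_d) : R :=
  \sum_(s < d) x 0 s * y 0 s.

Definition expi {R : realType} (x : R) : R[i] := (cos x +i* sin x)%C.

Section FiberOperators.
Context {R : realType} {d : nat} {Vs As : finType}.
Variable G : graph Vs As.

Definition degree (v : Vs) : nat := #|[pred e | src G e == v]|.

(* The points theta of the torus are given by representatives in R^d. *)
Definition fiber_laplacian (m : As -> 'rV[R]_d) (psi : As -> R)
    (theta : 'rV[R]_d) (f : Vs -> R[i]) (v : Vs) : R[i] :=
  (degree v)%:R * f v
  - \sum_(e | src G e == v) expi (psi e + dotp (m e) theta) * f (tgt G e).

Definition fiber_schroedinger (m : As -> 'rV[R]_d) (psi : As -> R)
    (Q : Vs -> R) (theta : 'rV[R]_d) (f : Vs -> R[i]) (v : Vs) : R[i] :=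
  fiber_laplacian m psi theta f v + ((Q v)%:C)%C * f v.

Definition fiber_perturbation (m : As -> 'rV[R]_d) (psi : As -> R)
    (theta : 'rV[R]_d) (f : Vs -> R[i]) (v : Vs) : R[i] :=
  fiber_laplacian m psi theta f v - fiber_laplacian m (fun=> 0) theta f v.

(* matrix of an operator in the canonical orthonormal basis of l^2(Vs) *)
Definition op_mx (T : (Vs -> R[i]) -> Vs -> R[i]) : 'M[R[i]]_#|Vs| :=
  \matrix_(i, j) T (fun u => (u == enum_val j)%:R) (enum_val i).

(* The eigenvalues with multiplicity, in nondecreasing order, of a self-adjoint
   operator T.  All the roots of the characteristic polynomial are then real,
   so that taking real parts only changes their type. *)
Definition eigenvalues (T : (Vs -> R[i]) -> Vs -> R[i]) : seq R :=
  sort <=%R [seq complex.Re z |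
              z <- sval (closed_field_poly_normal (char_poly (op_mx T)))].

(* numbered from 0: the n-th eigenvalue in the usual numbering is
   [eigenvalue_nth T n.-1] *)
Definition eigenvalue_nth (T : (Vs -> R[i]) -> Vs -> R[i]) (n : nat) : R :=
  nth 0 (eigenvalues T) n.

Definition band (m : As -> 'rV[R]_d) (psi : As -> R) (Q : Vs -> R) (n : nat) :
    set R :=
  range (fun theta => eigenvalue_nth (fiber_schroedinger m psi Q theta) n).

Definition tilde_form (m : As -> 'rV[R]_d) (phi : As -> R)
    (es : 'I_d -> As) (theta0 : 'rV[R]_d) (e : As) : R :=
  let inB := [exists s, (e == es s) || (e == rev G (es s))] in
  if ((e \in supp m) || (e \in supp phi)) && ~~ inB
  then phi e + dotp (m e) theta0 else 0.

(* The terms of the maximum are nonnegative, hence the default value 0. *)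
Definition C_const (psi : As -> R) : R :=
  2 * \big[Num.max/0]_(v : Vs)
        \sum_(e | (src G e == v) && (e \in supp psi)) `|sin (psi e / 2)|.

End FiberOperators.

Definition is_min_of {R : realType} {T : Type} (f : T -> R) (x : R) : Prop :=
  (exists t, f t = x) /\ forall t, x <= f t.

Definition is_max_of {R : realType} {T : Type} (f : T -> R) (x : R) : Prop :=
  (exists t, f t = x) /\ forall t, f t <= x.

(* Main.v *)
Require Import Defs.
From HB Require Import structures.
From mathcomp Require Import all_boot all_order all_algebra.
From mathcomp Require Import complex.
From mathcomp Require Import all_classical all_reals all_analysis.
From mathcomp Require Import sesquilinear spectral ring lra.

Set Implicit Arguments.
Unset Strict Implicit.
Unset Printing Implicit Defensive.

Import Order.TTheory GRing.Theory Num.Theory numFieldNormedType.Exports.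

Local Open Scope classical_set_scope.
Local Open Scope ring_scope.
Local Open Scope sesquilinear_scope.

(** The form phit equals phi + <m, theta0> on every edge ([tilde_form_shift]), so
    replacing phi by phit only translates the quasimomentum and leaves each band
    of the magnetic operator unchanged ([band_shift]).  At a fixed quasimomentum
    the magnetic operator is the nonmagnetic one plus X(theta), and Weyl's
    inequality ([weyl]) puts the difference of their n-th eigenvalues between the
    smallest and the largest eigenvalue of X(theta), hence between Lambda1 and
    Lambdanu ([schroedinger_perturbation]).  An inequality between functions passes
    to their minima and maxima, and therefore to the band edges and the band
    lengths ([periodic_ranges_close]).

    The bands are compact intervals, and Lambda1 and Lambdanu are attained, because
    the eigenvalues are continuous periodic functions on R^d ([periodic_extrema]).
    Continuity is again Weyl's inequality.  For periodicity, cycles of the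
    fundamental graph lift to walks of the periodic graph between translates of a
    vertex, so the coordinate form, and with it m, has integral fluxes
    ([coordinate_form_flux]).  Hence m is integral up to a gradient
    ([integral_flux_gauge]), and a translation of theta by 2 pi k conjugates the
    fiber operators, with and without the magnetic form, by one and the same
    diagonal unitary ([phase_periodic]).

    Finally the quadratic form of X(theta) is bounded by the largest sum of the
    absolute weights of the edges leaving a vertex ([qform_hopping_le]), which is
    the constant C of phit. *)

(** * Eigenvalues of Hermitian matrices *)

Lemma char_poly_similar (F : comUnitRingType) n (P A : 'M[F]_n) :
  P \in unitmx -> char_poly (invmx P *m A *m P) = char_poly A.
Proof.
move=> Pu; rewrite /char_poly.
have PP : map_mx (@polyC F) (invmx P) *m map_mx (@polyC F) P = 1%:M.
  by rewrite -map_mxM mulVmx // map_mx1.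
have -> : char_poly_mx (invmx P *m A *m P) =
    map_mx (@polyC F) (invmx P) *m char_poly_mx A *m map_mx (@polyC F) P.
  rewrite /char_poly_mx mulmxBr mulmxBl !map_mxM [in RHS]scalar_mxC.
  by rewrite -(mulmxA _ (map_mx _ (invmx P))) PP mulmx1.
by rewrite !det_mulmx mulrAC -det_mulmx PP det1 mul1r.
Qed.

Section SortedSeq.
Context {disp : Order.disp_t} {T : orderType disp}.
Implicit Type s : seq T.

Lemma count_lt_nth x0 s k : sorted <=%O s -> (k < size s)%N ->
  (count (fun x => x < nth x0 s k)%O s <= k)%N.
Proof.
move=> ss ks; rewrite -{2}(cat_take_drop k s) count_cat.
rewrite (_ : count _ (drop k s) = 0%N) ?addn0.
  by apply: leq_trans (count_size _ _) _; rewrite size_take ks.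
apply/eqP; rewrite -leqn0 leqNgt -has_count; apply/hasPn => x xd.
have [i id <-] := nthP x0 xd.
rewrite -leNgt nth_drop; move: id; rewrite size_drop => id.
apply: (sorted_leq_nth le_trans le_refl) => //; rewrite ?inE ?leq_addr//.
by rewrite -ltn_subRL.
Qed.

Lemma count_gt_nth x0 s k : sorted <=%O s -> (k < size s)%N ->
  (count (fun x => nth x0 s k < x)%O s <= size s - k.+1)%N.
Proof.
move=> ss ks; rewrite -{2}(cat_take_drop k.+1 s) count_cat.
rewrite (_ : count _ (take k.+1 s) = 0%N) ?add0n.
  by apply: leq_trans (count_size _ _) _; rewrite size_drop.
apply/eqP; rewrite -leqn0 leqNgt -has_count; apply/hasPn => x xd.
have [i id <-] := nthP x0 xd; move: id; rewrite size_takel // => id.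
rewrite -leNgt nth_take //.
apply: (sorted_leq_nth le_trans le_refl) => //; rewrite ?inE //.
exact: leq_trans id ks.
Qed.

End SortedSeq.

Section HermitianMatrices.
Context {R : realType} {n : nat}.
Local Notation C := R[i].
Implicit Types (A B P : 'M[C]_n) (x : 'rV[C]_n).

Definition mx_eigenvalues A : seq R :=
  sort <=%R [seq complex.Re z |
              z <- sval (closed_field_poly_normal (char_poly A))].

(** Vectors are rows, so that this is the form of the transpose of A, which has
    the same eigenvalues as A. *)
Definition qform A x : C := (x *m A *m x ^t*) 0 0.

Lemma qformD A B x : qform (A + B) x = qform A x + qform B x.
Proof. by rewrite /qform mulmxDr mulmxDl mxE. Qed.

Lemma qformE A x : qform A x = \sum_i \sum_j x 0 i * A i j * (x 0 j)^*%C.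
Proof.
rewrite /qform mxE exchange_big; apply: eq_bigr => j _.
by rewrite mxE big_distrl /=; apply: eq_bigr => i _; rewrite !mxE.
Qed.

Lemma qform1E x : qform 1%:M x = \sum_i `|x 0 i| ^+ 2.
Proof.
rewrite /qform mulmx1 mxE; apply: eq_bigr => i _.
by rewrite !mxE normCK.
Qed.

Definition eigval A (i : 'I_n) : R := complex.Re (spectral_diag A 0 i).

(** The components of x in an orthonormal eigenbasis of a Hermitian A. *)
Definition coords A x : 'rV[C]_n := x *m (spectralmx A) ^t*.

Lemma qform_coords A x : A \is hermsymmx ->
  qform A x = \sum_i (eigval A i)%:C%C * `|coords A x 0 i| ^+ 2.
Proof.
move=> hA; have /hermitian_normalmx /orthomx_spectralP A_eq := hA.
rewrite /qform {1}A_eq invmx_unitary ?spectral_unitarymx // !mulmxA.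
rewrite -/(coords A x) -mulmxA.
have -> : spectralmx A *m x ^t* = (coords A x) ^t*.
  by rewrite /coords trmx_mul map_mxM /= trmxCK.
rewrite mul_mx_diag mxE; apply: eq_bigr => i _.
rewrite !mxE normCK mulrAC mulrC; congr (_ * _).
have /mxOverP/(_ 0 i) := hermitian_spectral_diag_real hA.
by move=> /RRe_real.
Qed.

Lemma qform1_coords A x : qform 1%:M x = \sum_i `|coords A x 0 i| ^+ 2.
Proof.
rewrite -qform1E /qform /coords !mulmx1 trmx_mul map_mxM /= trmxCK mulmxA.
congr ((_ *m _) _ _); rewrite mulmxKtV //; exact: spectral_unitarymx.
Qed.

(** The characteristic polynomial is invariant under the change to an eigenbasis,
    where it splits into the linear factors given by the diagonal. *)
Lemma mx_eigenvalues_spectral A : A \is hermsymmx ->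
  mx_eigenvalues A = sort <=%R [seq eigval A i | i <- enum 'I_n].
Proof.
move=> hA; have /hermitian_normalmx /orthomx_spectralP A_eq := hA.
rewrite /mx_eigenvalues; case: closed_field_poly_normal => /= r.
rewrite (monicP (char_poly_monic A)) scale1r {1}A_eq.
rewrite char_poly_similar ?spectral_unit // char_poly_trig; last first.
  exact/diag_mx_is_trig.
rewrite -[in X in X = _](big_map (fun i => diag_mx (spectral_diag A) i i)
   predT (fun z => 'X - z%:P)) /=.
move=> /prod_XsubC_eq /(perm_map (@complex.Re R)) rE.
apply/perm_sortP; [exact: le_total|exact: le_trans|exact: le_anti|].
rewrite perm_sym; apply: perm_trans rE.
have -> : [seq complex.Re z | z <- [seq diag_mx (spectral_diag A) i i
    | i <- index_enum 'I_n]] = [seq eigval A i | i <- index_enum 'I_n].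
  by elim: (index_enum _) => //= i s ->; rewrite mxE eqxx mulr1n.
by rewrite enumT /index_enum unlock.
Qed.

End HermitianMatrices.

Section Weyl.
Context {R : realType} {n : nat}.
Local Notation C := R[i].
Implicit Types (A B : 'M[C]_n) (x : 'rV[C]_n) (k : nat).

Lemma size_mx_eigenvalues A : A \is hermsymmx -> size (mx_eigenvalues A) = n.
Proof.
move=> hA.
by rewrite mx_eigenvalues_spectral // size_sort size_map size_enum_ord.
Qed.

Lemma sorted_mx_eigenvalues A : sorted <=%R (mx_eigenvalues A).
Proof. exact/sort_sorted/le_total. Qed.

Lemma count_mx_eigenvalues A (p : pred R) : A \is hermsymmx ->
  #|[pred i | p (eigval A i)]| = count p (mx_eigenvalues A).
Proof.
move=> hA; rewrite mx_eigenvalues_spectral // (permP (permEl (perm_sort _ _))).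
rewrite count_map enumT cardE /enum_mem size_filter; exact: eq_count.
Qed.

Lemma mx_eigenvalues_eigval A k : A \is hermsymmx -> (k < n)%N ->
  exists i, nth 0 (mx_eigenvalues A) k = eigval A i.
Proof.
move=> hA kn; have : nth 0 (mx_eigenvalues A) k \in mx_eigenvalues A.
  by rewrite mem_nth ?size_mx_eigenvalues.
rewrite {2}mx_eigenvalues_spectral // mem_sort => /mapP[i _ ->].
by exists i.
Qed.

Lemma eigval_mx_eigenvalues A i : A \is hermsymmx ->
  exists2 k, (k < n)%N & eigval A i = nth 0 (mx_eigenvalues A) k.
Proof.
move=> hA; have : eigval A i \in mx_eigenvalues A.
  by rewrite mx_eigenvalues_spectral // mem_sort map_f ?mem_enum.
by move=> /(nthP 0)[k]; rewrite size_mx_eigenvalues // => kn <-; exists k.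
Qed.

(** Each vanishing component is one linear condition on x, and there are fewer
    conditions than dimensions. *)
Lemma coords_common A B (S T : pred 'I_n) : (#|S| + #|T| < n)%N ->
  exists x, [/\ x != 0, forall i, S i -> coords A x 0 i = 0
              & forall i, T i -> coords B x 0 i = 0].
Proof.
move=> ST.
pose K : 'M[C]_(n, #|S| + #|T|) :=
  row_mx (colsub (fun i : 'I_#|S| => enum_val i) ((spectralmx A) ^t*))
         (colsub (fun i : 'I_#|T| => enum_val i) ((spectralmx B) ^t*)).
have : kermx K != 0.
  rewrite -mxrank_eq0 mxrank_ker subn_eq0 -ltnNge.
  exact: leq_ltn_trans (rank_leq_col _) ST.
case/rowV0Pn => x /sub_kermxP xK x0; exists x.
move: xK; rewrite mul_mx_row -[0]hsubmxK => /eq_row_mx[xS xT].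
split=> // i Pi.
  have Si : i \in S := Pi.
  have /matrixP/(_ 0 (enum_rank_in Si i)) := xS.
  rewrite /coords !mxE => E; rewrite -[RHS]E; apply: eq_bigr => j _.
  by rewrite [in RHS]mxE enum_rankK_in.
have Si : i \in T := Pi.
have /matrixP/(_ 0 (enum_rank_in Si i)) := xT.
rewrite /coords !mxE => E; rewrite -[RHS]E; apply: eq_bigr => j _.
by rewrite [in RHS]mxE enum_rankK_in.
Qed.

Lemma qform1_gt0 x : x != 0 -> 0 < qform 1%:M x.
Proof.
move=> x0; rewrite qform1E lt_neqAle eq_sym psumr_neq0 => [|i _]; last first.
  exact: exprn_ge0.
apply/andP; split; last by apply: sumr_ge0 => i _; apply: exprn_ge0.
move: x0; rewrite -subr_eq0 => /eqP x0; apply/hasP.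
case: (pselect (exists i, x 0 i != 0)) => [[i xi]|H].
  by exists i; rewrite ?mem_index_enum //= exprn_gt0 // normr_gt0.
case: x0; rewrite subr0; apply/rowP => i; rewrite mxE.
by apply/eqP; apply: contrapT => /negP xi; apply: H; exists i.
Qed.

(** Weyl's monotonicity principle.  Let a and b be the eigenvalues of index k of A
    and B.  At most k eigenvalues of A lie strictly below a, and at most n - k - 1
    eigenvalues of B strictly above b.  Hence some nonzero x has no component along the
    corresponding eigenvectors; on this x the form of A is at least a |x|^2, that
    of B at most b |x|^2. *)
Lemma weyl A B (c : R) k : A \is hermsymmx -> B \is hermsymmx -> (k < n)%N ->
  (forall x, qform A x <= qform B x + c%:C%C * qform 1%:M x) ->
  nth 0 (mx_eigenvalues A) k <= nth 0 (mx_eigenvalues B) k + c.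
Proof.
move=> hA hB kn AB.
pose a := nth 0 (mx_eigenvalues A) k; pose b := nth 0 (mx_eigenvalues B) k.
pose S := [pred i | eigval A i < a]; pose T := [pred i | b < eigval B i].
have Sk : (#|S| <= k)%N.
  rewrite (count_mx_eigenvalues (fun y => y < a)) //.
  by rewrite count_lt_nth ?sorted_mx_eigenvalues // size_mx_eigenvalues.
have Tk : (#|T| <= n - k.+1)%N.
  rewrite (count_mx_eigenvalues (fun y => b < y)) //.
  rewrite -{2}(size_mx_eigenvalues hB).
  by rewrite count_gt_nth ?sorted_mx_eigenvalues // size_mx_eigenvalues.
have /(coords_common A B)[x [x0 xS xT]] : (#|S| + #|T| < n)%N.
  by apply: leq_ltn_trans (leq_add Sk Tk) _; rewrite -addSn subnKC.
have x1 := qform1_gt0 x0.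
have Ax : a%:C%C * qform 1%:M x <= qform A x.
  rewrite (qform_coords _ hA) (qform1_coords A) mulr_sumr ler_sum // => i _.
  have [/xS ->|] := boolP (S i); first by rewrite normr0 expr0n /= !mulr0.
  by rewrite /= -leNgt => ai; rewrite ler_wpM2r ?exprn_ge0 // lecR.
have Bx : qform B x <= b%:C%C * qform 1%:M x.
  rewrite (qform_coords _ hB) (qform1_coords B) mulr_sumr ler_sum // => i _.
  have [/xT ->|] := boolP (T i); first by rewrite normr0 expr0n /= !mulr0.
  by rewrite /= -leNgt => ai; rewrite ler_wpM2r ?exprn_ge0 // lecR.
rewrite -lecR -(ler_pM2r x1); apply: le_trans Ax (le_trans (AB x) _).
by rewrite rmorphD mulrDl lerD2r.
Qed.

Lemma qform_real A x : A \is hermsymmx -> qform A x \is Num.real.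
Proof.
move=> hA; rewrite qform_coords // rpred_sum // => i _.
by rewrite rpredM ?rpredX ?normr_real // complex_real.
Qed.

Lemma qform_le_last A x : A \is hermsymmx ->
  qform A x <= (nth 0 (mx_eigenvalues A) n.-1)%:C%C * qform 1%:M x.
Proof.
move=> hA; rewrite (qform_coords _ hA) (qform1_coords A) mulr_sumr ler_sum // => i _.
rewrite ler_wpM2r ?exprn_ge0 // lecR.
have [k kn ->] := eigval_mx_eigenvalues i hA.
have n0 : (0 < n)%N by exact: leq_ltn_trans kn.
apply: (sorted_leq_nth le_trans le_refl) => //;
  rewrite ?inE ?size_mx_eigenvalues ?sorted_mx_eigenvalues ?prednK //.
by rewrite -ltnS prednK.
Qed.

Lemma qform_ge_first A x : A \is hermsymmx ->
  (nth 0 (mx_eigenvalues A) 0)%:C%C * qform 1%:M x <= qform A x.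
Proof.
move=> hA; rewrite (qform_coords _ hA) (qform1_coords A) mulr_sumr ler_sum // => i _.
rewrite ler_wpM2r ?exprn_ge0 // lecR.
have [k kn ->] := eigval_mx_eigenvalues i hA.
have n0 : (0 < n)%N by exact: leq_ltn_trans kn.
by apply: (sorted_leq_nth le_trans le_refl) => //;
  rewrite ?inE ?size_mx_eigenvalues ?sorted_mx_eigenvalues.
Qed.

(** A unit eigenvector: a row of the diagonalizing unitary matrix. *)
Lemma eigval_qform A i : A \is hermsymmx ->
  exists2 x, qform 1%:M x = 1 & qform A x = (eigval A i)%:C%C.
Proof.
move=> hA; have /unitarymxP PP := spectral_unitarymx A.
exists (row i (spectralmx A)).
  rewrite (qform1_coords A) /coords -row_mul.
  rewrite PP (bigD1 i) //= big1 ?addr0.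
    by rewrite !mxE eqxx normr1 expr1n.
  by move=> j ji; rewrite !mxE eq_sym (negPf ji) normr0 expr0n.
rewrite (qform_coords _ hA) /coords -row_mul.
rewrite PP (bigD1 i) //= big1 ?addr0.
  by rewrite !mxE eqxx normr1 expr1n mulr1.
by move=> j ji; rewrite !mxE eq_sym (negPf ji) normr0 expr0n mulr0.
Qed.

Lemma mx_eigenvalues_bounded A (c : R) k : A \is hermsymmx -> (k < n)%N ->
  (forall x, `|qform A x| <= c%:C%C * qform 1%:M x) ->
  `|nth 0 (mx_eigenvalues A) k| <= c.
Proof.
move=> hA kn Ac; have [i ->] := mx_eigenvalues_eigval hA kn.
have [x x1 Ax] := eigval_qform i hA.
have := Ac x; rewrite x1 Ax mulr1 normc_def /= expr0n /= addr0 sqrtr_sqr.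
by rewrite lecR.
Qed.

End Weyl.

(** * Unit complex numbers *)

Section Expi.
Context {R : realType}.
Implicit Types a b : R.

Lemma expiD a b : expi (a + b) = expi a * expi b.
Proof.
rewrite /expi cosD sinD; apply/eqP; rewrite eq_complex /= eqxx /=.
by rewrite addrC mulrC [sin a * _]mulrC [sin b * _]mulrC.
Qed.

Lemma expiN a : expi (- a) = (expi a)^*%C.
Proof. by rewrite /expi cosN sinN. Qed.

Lemma expi0 : expi (0 : R) = 1.
Proof. by rewrite /expi cos0 sin0. Qed.

Lemma norm_expi a : `|expi a| = 1.
Proof. by rewrite normc_def /= cos2Dsin2 sqrtr1. Qed.

Lemma expi_2piz (k : int) : expi (2 * pi * k%:~R : R) = 1.
Proof.
wlog : k / exists n : nat, k = n => [H|[n ->]].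
  case: k => n; first by apply: H; exists n.
  rewrite NegzE rmorphN mulrN expiN H ?conjc1 //; by exists n.+1.
rewrite -[n%:~R]/(n%:R); elim: n => [|n IH]; first by rewrite mulr0 expi0.
rewrite -[n.+1%:R]natr1 mulrDr mulr1 expiD IH mul1r /expi.
by rewrite mulrC mulr_natr cos2pi sin2pi.
Qed.

(** Factor out the midpoint phase: what remains is z minus its conjugate, with z
    the phase of the half difference. *)
Lemma norm_expiB a b : `|expi a - expi b| = (2 * `|sin ((a - b) / 2)|)%:C%C.
Proof.
have -> : expi a - expi b =
    expi ((a + b) / 2) * (expi ((a - b) / 2) - (expi ((a - b) / 2))^*%C).
  rewrite mulrBr -expiN -!expiD; congr (expi _ - expi _); by field.
rewrite normrM norm_expi mul1r /expi /= normc_def /= subrr expr0n add0r opprK.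
by rewrite sqrtr_sqr -mulr2n -[sin _ *+ 2]mulr_natl normrM ger0_norm.
Qed.

Lemma norm_sin_le a : `|sin a| <= `|a|.
Proof.
wlog a0 : a / 0 <= a => [H|].
  have [/H//|/ltW a0] := leP 0 a.
  by rewrite -normrN -sinN -[leRHS]normrN H // oppr_ge0.
have [c _] : exists2 c : R, c \in `[0, a] & sin a - sin 0 = cos c * (a - 0).
  apply: MVT_segment => //.
  by apply: continuous_subspaceT => x; exact: continuous_sin.
by rewrite sin0 !subr0 => ->; rewrite normrM ler_piMl // cos_max.
Qed.

Lemma norm_expiB_le a b : `|expi a - expi b| <= `|a - b|%:C%C.
Proof.
rewrite norm_expiB lecR; apply: le_trans (ler_wpM2l _ (norm_sin_le _)) _ => //.
by rewrite normrM [`|2^-1|]ger0_norm ?invr_ge0 // mulrCA divff ?mulr1.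
Qed.

End Expi.

(** * Hopping matrices of a finite graph *)

Section HoppingMatrices.
Context {R : realType} {Vs As : finType}.
Variable G : graph Vs As.
Local Notation C := R[i].
Implicit Types (q : Vs -> R) (w : As -> C).

(** The common form of the fiber Schroedinger operators and of their
    perturbations: a real potential q minus the sum of edge weights.  Weights are
    summed over parallel edges, and loops contribute to the diagonal. *)
Definition hopping q w : 'M[C]_#|Vs| :=
  \matrix_(i, j) ((q (enum_val i))%:C%C * (i == j)%:R
    - \sum_(e | (src G e == enum_val i) && (tgt G e == enum_val j)) w e).

Definition hermitian_weight w : Prop := forall e, w (Defs.rev G e) = (w e)^*%C.

Lemma tgt_rev e : tgt G (Defs.rev G e) = src G e.
Proof. by rewrite -(src_rev G (Defs.rev G e)) Defs.revK. Qed.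

Lemma hopping_hermitian q w : hermitian_weight w -> hopping q w \is hermsymmx.
Proof.
move=> hw; apply/is_hermitianmxP; rewrite expr0 scale1r.
apply/matrixP => i j; rewrite !mxE rmorphB rmorphM rmorph_nat /=.
congr (_ - _).
  have [->|ij] := eqVneq i j; last by rewrite !mulr0.
  by rewrite -[Num.conj _]/(conjc _) /= oppr0.
rewrite rmorph_sum (reindex_inj (inv_inj (Defs.revK G))) /=.
by apply: eq_big => [e|e _]; rewrite ?src_rev ?tgt_rev ?hw 1?andbC.
Qed.

Lemma hopping_split q w w' :
  hopping q w = hopping q w' + hopping (fun=> 0) (fun e => w e - w' e).
Proof.
apply/matrixP => i j; rewrite !mxE mul0r add0r sumrB opprB addrA subrK //.
Qed.

Lemma qform_hopping w (x : 'rV[C]_#|Vs|) :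
  qform (hopping (fun=> 0) w) x =
  - \sum_e x 0 (enum_rank (src G e)) * w e * (x 0 (enum_rank (tgt G e)))^*%C.
Proof.
rewrite qformE -sumrN.
rewrite (partition_big (fun e => enum_rank (src G e)) predT) //=.
apply: eq_bigr => i _.
rewrite (partition_big (fun e => enum_rank (tgt G e)) predT) //=.
apply: eq_bigr => j _.
rewrite mxE mul0r add0r mulrN mulNr mulr_sumr mulr_suml -sumrN.
apply: eq_big => [e|e /andP[/eqP se /eqP te]].
  by rewrite !(can2_eq (@enum_rankK Vs) (@enum_valK Vs)).
by rewrite se te !enum_valK.
Qed.

(** By the inequality of arithmetic and geometric means, an edge with ends s and
    t contributes at most |w e| (|x_s|^2 + |x_t|^2) / 2.  Orientation reversal
    exchanges s and t and keeps |w e|, so both halves have the same sum, and c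
    bounds the weights leaving each vertex. *)
Lemma qform_hopping_le w (c : R) (x : 'rV[C]_#|Vs|) : hermitian_weight w ->
  (forall v, \sum_(e | src G e == v) `|w e| <= c%:C%C) ->
  `|qform (hopping (fun=> 0) w) x| <= c%:C%C * qform 1%:M x.
Proof.
move=> hw wc; rewrite qform_hopping normrN.
pose y v : C := `|x 0 (enum_rank v)|.
apply: le_trans (ler_norm_sum _ _ _) _.
have amgm e : `|x 0 (enum_rank (src G e)) * w e *
    (x 0 (enum_rank (tgt G e)))^*%C| <=
    (`|w e| * y (src G e) ^+ 2 + `|w e| * y (tgt G e) ^+ 2) / 2.
  rewrite !normrM normcJ -/(y _) -/(y _) -mulrDr.
  rewrite [_ * `|w e|]mulrC -!mulrA ler_wpM2l //.
  have y0 v : y v \is Num.real by exact: normr_real.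
  rewrite ler_pdivlMr // -subr_ge0.
  have := real_exprn_even_ge0 (n := 2) (rpredB (y0 (src G e)) (y0 (tgt G e))) isT.
  by congr (0 <= _); ring.
apply: le_trans (ler_sum _ (fun e _ => amgm e)) _.
rewrite -mulr_suml big_split /= [X in _ + X](_ : _ =
    \sum_e `|w e| * y (src G e) ^+ 2).
  rewrite -mulr2n -[X in X / 2]mulr_natr mulfK ?pnatr_eq0 //.
  rewrite (partition_big (src G) predT) //= qform1E mulr_sumr.
  rewrite [leRHS](reindex (@enum_rank Vs)) /=; last first.
    exact/onW_bij/enum_rank_bij.
  apply: ler_sum => v _.
  rewrite (eq_bigr (fun e => `|w e| * y v ^+ 2)) => [|e /eqP -> //].
  by rewrite -mulr_suml ler_wpM2r ?exprn_ge0 ?wc ?normr_ge0.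
rewrite (reindex_inj (inv_inj (Defs.revK G))) /=.
by apply: eq_bigr => e _; rewrite tgt_rev hw normcJ.
Qed.

(** A gauge transformation is a conjugation by a diagonal unitary matrix. *)
Lemma hopping_gauge q w w' (u : Vs -> C) : (forall v, `|u v| = 1) ->
  (forall e, w' e = u (src G e) * w e * (u (tgt G e))^*%C) ->
  mx_eigenvalues (hopping q w') = mx_eigenvalues (hopping q w).
Proof.
move=> u1 w'E; pose D : 'M[C]_#|Vs| := diag_mx (\row_i (u (enum_val i))^*%C).
pose D' : 'M[C]_#|Vs| := diag_mx (\row_i u (enum_val i)).
have uu v : u v * (u v)^*%C = 1 by rewrite -sqr_normc u1 expr1n.
have DD : D' *m D = 1%:M.
  rewrite mulmx_diag; apply/matrixP => i j.
  by rewrite !mxE uu.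
have [Du Dunit] := mulmx1_unit DD.
have DV : invmx D = D'.
  by rewrite -[LHS]mul1mx -DD mulmxK.
rewrite /mx_eigenvalues -(char_poly_similar (hopping q w) Dunit) DV.
congr (sort _ [seq _ | z <- sval (closed_field_poly_normal (char_poly _))]).
apply/matrixP => i j; rewrite mul_diag_mx mul_mx_diag !mxE mulrBr mulrBl.
congr (_ - _).
  have [->|ij] := eqVneq i j; last by rewrite !mulr0 mul0r.
  by rewrite mulrAC uu mul1r.
rewrite mulr_sumr mulr_suml; apply: eq_bigr => e /andP[/eqP se /eqP te].
by rewrite w'E se te.
Qed.

End HoppingMatrices.

(** * Integrality of the fluxes *)

Section PeriodicFundamental.
Context {R : realType} {d : nat} {V A : Type} (P : periodic_graph R d V A).
Context {Vs As : finType} (G : fundamental_graph P Vs As).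

Lemma tgt_etrans n e : tgt P (Defs.etrans P n e) = vtrans P n (tgt P e).
Proof. by rewrite -!src_rev rev_etrans src_etrans. Qed.

Lemma tgt_eproj e : tgt G (eproj G e) = vproj G (tgt P e).
Proof. by rewrite -!src_rev rev_eproj src_eproj. Qed.

Lemma coordinate_form_eproj e : coordinate_form G (eproj G e) =
  lat_coord P (pos P (tgt P e)) - lat_coord P (pos P (src P e)).
Proof.
rewrite /coordinate_form /Defs.induced; case: (cid (eproj_surj G (eproj G e))) => e' /= /esym/eprojP[n ->].
rewrite src_etrans tgt_etrans !pos_vtrans /lat_coord -!mulmxBl.
by rewrite opprD addrACA subrr addr0.
Qed.

Lemma fundamental_connected : graph_connected G.
Proof.
move=> x y; have [u <-] := vproj_surj G x; have [v <-] := vproj_surj G y.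
have [p] := pg_connected P u v; elim: p u => [u ->|e p IH u [<- /IH[q qw]]].
  by exists [::].
by exists (eproj G e :: q); split; rewrite /= ?src_eproj // tgt_eproj.
Qed.

(** Walks of the quotient lift to the periodic graph, where the coordinate form
    telescopes. *)
Lemma walk_lift x c y u : walk G x c y -> vproj G u = x ->
  exists v, vproj G v = y /\
    flux (coordinate_form G) c = lat_coord P (pos P v) - lat_coord P (pos P u).
Proof.
elim: c x u => [|a c IH] x u.
  by move=> <- ux; exists u; rewrite /flux big_nil subrr.
case=> sa cw ux; have [e ea] := eproj_surj G a.
have /vprojP[n un] : vproj G (src P e) = vproj G u.
  by rewrite -src_eproj ea sa ux.
have fa : eproj G (Defs.etrans P n e) = a by rewrite -ea; apply/esym/eprojP; exists n.
have ff : vproj G (tgt P (Defs.etrans P n e)) = tgt G a by rewrite -tgt_eproj fa.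
have [v [vy vf]] := IH _ _ cw ff.
exists v; split=> //; rewrite /flux big_cons -/(flux _ c) vf.
by rewrite -fa coordinate_form_eproj src_etrans -un addrC addrA subrK.
Qed.

(** The lift of a cycle joins two vertices in the same orbit, and the flux is the
    coordinate vector of the translation between them. *)
Lemma coordinate_form_flux c : is_cycle G c ->
  exists n : 'rV[int]_d, flux (coordinate_form G) c = map_mx intr n.
Proof.
case=> x cx; have [u ux] := vproj_surj G x.
have [v [vx ->]] := walk_lift cx ux.
have /vprojP[n ->] : vproj G u = vproj G v by rewrite ux vx.
exists n; rewrite pos_vtrans /lat_coord mulmxDl addrC addKr.
by rewrite mulmxK // lat_basis_unit.
Qed.

End PeriodicFundamental.

Section Gauge.
Context {R : realType} {d : nat} {Vs As : finType}.
Variables (G : graph Vs As) (m : As -> 'rV[R]_d).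
Hypothesis G_connected : graph_connected G.
Hypothesis m_integral : forall c, is_cycle G c ->
  exists n : 'rV[int]_d, flux m c = map_mx intr n.

Lemma walk_cat u p v q w : walk G u p v -> walk G v q w -> walk G u (p ++ q) w.
Proof.
elim: p u => [u -> //|e p IH u /= [<- pw qw]]; split=> //; exact: IH.
Qed.

(** The potential g v is the flux of m along a chosen walk from a root r to v.
    Closing both the walk to the end of e and the walk to the start of e followed
    by e with the same return walk to r gives two cycles; subtracting their fluxes
    eliminates the return walk. *)
Lemma integral_flux_gauge : exists g : Vs -> 'rV[R]_d,
  forall e, exists n : 'rV[int]_d, m e = g (tgt G e) - g (src G e) + map_mx intr n.
Proof.
have [[r]|Vs0] := pselect (inhabited Vs); last first.
  by exists (fun=> 0) => e; case: Vs0; exists; exact: src G e.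
have /choice[p pw] : forall v, exists p, walk G r p v by move=> v; exact: G_connected.
exists (fun v => flux m (p v)) => e.
have [q qw] := G_connected (tgt G e) r.
have [|k kE] := @m_integral (p (tgt G e) ++ q).
  by exists r; exact: walk_cat qw.
have [|l lE] := @m_integral (p (src G e) ++ e :: q).
  by exists r; apply: walk_cat (pw _) _.
exists (l - k); rewrite map_mxB -lE -kE /flux !big_cat big_cons /=.
set t := \sum_(_ <- p (tgt G e)) _; set s := \sum_(_ <- p _) _.
by apply/rowP => i; rewrite !mxE; ring.
Qed.

End Gauge.

(** * Fiber operators as hopping matrices *)

Section Phases.
Context {R : realType} {d : nat}.
Implicit Types x y : 'rV[R]_d.

Lemma dotpDr x y y' : dotp x (y + y') = dotp x y + dotp x y'.
Proof. by rewrite -big_split; apply: eq_bigr => s _; rewrite mxE mulrDr. Qed.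

Lemma dotpDl x x' y : dotp (x + x') y = dotp x y + dotp x' y.
Proof. by rewrite -big_split; apply: eq_bigr => s _; rewrite mxE mulrDl. Qed.

Lemma dotpNl x y : dotp (- x) y = - dotp x y.
Proof. by rewrite -sumrN; apply: eq_bigr => s _; rewrite mxE mulNr. Qed.

Lemma dotp0l y : dotp 0 y = 0.
Proof. by apply: big1 => s _; rewrite mxE mul0r. Qed.

Lemma dotp_continuous x : continuous (dotp x).
Proof.
apply: continuous_big => [|s _ y]; first exact: add_continuous.
apply: (@cvgM R _ (nbhs y) _ (fun=> x 0 s) (fun z : 'rV[R]_d => z 0 s)).
  exact: cvg_cst.
exact: coord_continuous.
Qed.

Lemma expi_dotp_intr (k l : 'rV[int]_d) :
  expi (dotp (map_mx intr k) (2 * pi *: map_mx intr l)) = 1 :> R[i].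
Proof.
rewrite (_ : dotp _ _ = 2 * pi * (\sum_(s < d) k 0 s * l 0 s)%:~R) ?expi_2piz //.
rewrite rmorph_sum /= mulr_sumr; apply: eq_bigr => s _.
by rewrite !mxE rmorphM mulrCA.
Qed.

End Phases.

Section FiberMatrices.
Context {R : realType} {d : nat} {Vs As : finType}.
Variable G : graph Vs As.
Variable m : As -> 'rV[R]_d.
Implicit Types (psi : As -> R) (theta : 'rV[R]_d) (q : Vs -> R).

Definition phase psi theta (e : As) : R[i] := expi (psi e + dotp (m e) theta).

Lemma eigenvalue_nthE (T : (Vs -> R[i]) -> Vs -> R[i]) n :
  eigenvalue_nth T n = nth 0 (mx_eigenvalues (op_mx T)) n.
Proof. by []. Qed.

Lemma op_mx_schroedinger psi q theta :
  op_mx (fiber_schroedinger G m psi q theta) =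
  hopping G (fun v => (degree G v)%:R + q v) (phase psi theta).
Proof.
apply/matrixP => i j; rewrite !mxE /fiber_schroedinger /fiber_laplacian.
rewrite (inj_eq enum_val_inj) addrAC -mulrDl rmorphD rmorph_nat.
congr (_ - _).
rewrite [RHS]big_mkcondr /=; apply: eq_bigr => e _; rewrite /phase.
by case: eqP; rewrite ?mulr1 ?mulr0.
Qed.

Lemma op_mx_perturbation psi theta :
  op_mx (fiber_perturbation G m psi theta) =
  hopping G (fun=> 0) (fun e => phase psi theta e - phase (fun=> 0) theta e).
Proof.
apply/matrixP => i j; rewrite !mxE /fiber_perturbation /fiber_laplacian.
rewrite mul0r add0r opprB addrC addrA subrK -opprB -sumrB; congr (- _).
rewrite [RHS]big_mkcondr /=; apply: eq_bigr => e _; rewrite -mulrBl.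
by case: eqP; rewrite ?mulr1 ?mulr0.
Qed.

Hypothesis m_form : one_form G m.

Lemma phase_hermitian psi theta :
  one_form G psi -> hermitian_weight G (phase psi theta).
Proof. by move=> hpsi e; rewrite /phase hpsi m_form dotpNl -opprD expiN. Qed.

Lemma phaseB_hermitian psi theta psi' theta' :
  one_form G psi -> one_form G psi' ->
  hermitian_weight G (fun e => phase psi theta e - phase psi' theta' e).
Proof. by move=> hp hp' e; rewrite !phase_hermitian // rmorphB. Qed.

Lemma zero_form : one_form G (fun=> 0 : R).
Proof. by move=> e; rewrite oppr0. Qed.

(** A pseudodistance on quasimomenta in which all eigenvalue functions are
    Lipschitz; it controls the phases of all edges at once. *)
Definition phase_dist theta theta' : R := 
  \sum_e `|dotp (m e) theta - dotp (m e) theta'|.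

Lemma phaseB_le psi theta theta' v :
  \sum_(e | src G e == v) `|phase psi theta e - phase psi theta' e| <=
  (phase_dist theta theta')%:C%C.
Proof.
rewrite /phase_dist rmorph_sum /= [leRHS](bigID (fun e => src G e == v)) /=.
apply: ler_wpDr; first by apply: sumr_ge0 => e _; rewrite ler0c.
apply: ler_sum => e _; apply: le_trans (norm_expiB_le _ _) _.
by rewrite opprD addrACA subrr add0r.
Qed.

(** By Weyl's inequality, the eigenvalues of hopping matrices are Lipschitz in
    the weights, for the distance given by the largest total change at a vertex:
    it bounds the quadratic form of the difference. *)
Lemma hopping_eigenvalues_dist q (w w' : As -> R[i]) (c : R) k :
  hermitian_weight G w -> hermitian_weight G w' -> (k < #|Vs|)%N ->
  (forall v, \sum_(e | src G e == v) `|w e - w' e| <= c%:C%C) ->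
  `|nth 0 (mx_eigenvalues (hopping G q w)) k -
    nth 0 (mx_eigenvalues (hopping G q w')) k| <= c.
Proof.
move=> hw hw' kV wc.
suff H v v' : hermitian_weight G v -> hermitian_weight G v' ->
    (forall x, \sum_(e | src G e == x) `|v e - v' e| <= c%:C%C) ->
    nth 0 (mx_eigenvalues (hopping G q v)) k <=
    nth 0 (mx_eigenvalues (hopping G q v')) k + c.
  rewrite ler_distl; apply/andP; split; last exact: H.
  rewrite lerBlDr; apply: H => // x.
  by under eq_bigr do rewrite distrC; exact: wc.
move=> {}hw {}hw' {}wc.
have hvv : hermitian_weight G (fun e => v e - v' e).
  by move=> e; rewrite hw hw' rmorphB.
apply: (weyl (hopping_hermitian _ hw) (hopping_hermitian _ hw') kV) => x.
rewrite (hopping_split G q v v') qformD lerD2l.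
apply: le_trans (qform_hopping_le x hvv wc).
by apply: real_ler_norm; apply: qform_real; exact: hopping_hermitian.
Qed.

End FiberMatrices.

(** * Continuous functions on the torus *)

Section TorusFunctions.
Context {R : realType} {d : nat}.
Implicit Types (f : 'rV[R]_d -> R) (theta : 'rV[R]_d).

Definition lattice_periodic f : Prop := forall theta (k : 'rV[int]_d),
  f (theta + 2 * pi *: map_mx intr k) = f theta.

Lemma phase_dist_continuous (As : finType) (m : As -> 'rV[R]_d) f (K : R) :
  (forall x y, `|f x - f y| <= K * phase_dist m x y) -> continuous f.
Proof.
move=> fK x; apply/(@cvgrPdist_le R R _ (nbhs x)) => eps eps0.
have h : (fun y => K * phase_dist m x y) @ x --> (0 : R).
  have -> : (0 : R) = K * phase_dist m x x.
    rewrite /phase_dist big1 ?mulr0 // => e _.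
    by rewrite subrr normr0.
  apply: (@cvgM R _ (nbhs x) _ (fun=> K) (fun y => phase_dist m x y)).
    exact: cvg_cst.
  apply: continuous_big => [|e _ y]; first exact: add_continuous.
  apply: (@cvg_norm R R _ (nbhs y)).
  apply: (@cvgB R R _ (nbhs y) _ (fun=> dotp (m e) x) (dotp (m e))).
    exact: cvg_cst.
  exact: dotp_continuous.
move/(@cvgrPdist_le R R _ (nbhs x)) : h => /(_ eps eps0); apply: filterS => y; rewrite sub0r normrN.
by move=> h; apply: le_trans (fK x y) (le_trans (ler_norm _) h).
Qed.

(** Subtracting 2 pi times the floor of theta_s / (2 pi) in each coordinate moves theta into a compact box. *)
Lemma torus_representative theta : exists k : 'rV[int]_d,
  forall s, 0 <= (theta + 2 * pi *: map_mx intr k) 0 s <= 2 * pi.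
Proof.
have pi2 : 0 < 2 * pi :> R by rewrite mulr_gt0 ?pi_gt0.
exists (\row_s - Num.floor (theta 0 s / (2 * pi))) => s.
rewrite !mxE rmorphN mulrN subr_ge0 lerBlDr.
have := floor_itv (theta 0 s / (2 * pi)).
rewrite ler_pdivlMr // ltr_pdivrMr // mulrC => /andP[-> /ltW] /=.
by rewrite rmorphD mulrDl mul1r [_%:~R * _]mulrC addrC.
Qed.

(** The values on a compact fundamental box are all values, so the extrema are
    attained; intermediate values are taken on the segment joining the two
    extremal points. *)
Lemma periodic_extrema f : continuous f -> lattice_periodic f ->
  exists tmin tmax, [/\ forall t, f tmin <= f t, forall t, f t <= f tmax
                     & range f = `[f tmin, f tmax]%classic].
Proof.
move=> fc fp.
pose B : set 'rV[R]_d := [set v | forall s, `[0, 2 * pi]%classic (v ord0 s)].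
have Bc : compact B.
  by apply: (@rV_compact R d (fun=> `[0, 2 * pi]%classic)) => s; exact: segment_compact.
have B0 : B !=set0.
  exists 0 => s /=; rewrite mxE in_itv /= lexx mulr_ge0 //; exact: pi_ge0.
have fB : {within B, continuous f} by exact: continuous_subspaceT.
have fBE t : exists2 t', t' \in B & f t' = f t.
  have [k kB] := torus_representative t.
  exists (t + 2 * pi *: map_mx intr k); last exact: fp.
  by apply/mem_set => s /=; rewrite in_itv /= kB.
have [tmin _ fmin] := EVT_min_rV B0 Bc fB.
have [tmax _ fmax] := EVT_max_rV B0 Bc fB.
have gmin t : f tmin <= f t by have [t' /fmin + <-] := fBE t.
have gmax t : f t <= f tmax by have [t' /fmax + <-] := fBE t.
exists tmin, tmax; split=> //; apply/seteqP; split=> [_ [t _ <-]|y /=].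
  by rewrite /= in_itv /= gmin gmax.
rewrite in_itv /= => yI.
pose l (s : R) : 'rV[R]_d := tmin + s *: (tmax - tmin).
have lc : continuous l.
  move=> s; apply: cvgD; first exact: cvg_cst.
  by apply: cvgZr_tmp; exact: cvg_id.
have [||s _ sy] := @IVT R (f \o l) 0 1 y ler01.
- apply: continuous_subspaceT => s; apply: continuous_comp; first exact: lc.
  exact: fc.
- rewrite /= /l scale0r addr0 scale1r subrKC.
  by rewrite (min_idPl (gmin _)) (max_idPr (gmin _)).
by exists (l s).
Qed.

(** Each bound on f - g is used at an extremal point of f or of g, where one of
    the two functions equals its extremum and the other is only bounded by its
    own. *)
Lemma periodic_ranges_close f g (l u : R) :
  continuous f -> lattice_periodic f -> continuous g -> lattice_periodic g ->
  (forall t, l <= f t - g t <= u) ->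
  exists f_m f_p g_m g_p : R,
    [/\ range f = `[f_m, f_p]%classic /\ range g = `[g_m, g_p]%classic,
        l <= f_m - g_m <= u, l <= f_p - g_p <= u
      & `|(f_p - f_m) - (g_p - g_m)| <= u - l].
Proof.
move=> fc fp gc gp fg.
have [a [b [fa fb fE]]] := periodic_extrema fc fp.
have [c [e [gc' ge gE]]] := periodic_extrema gc gp.
exists (f a), (f b), (g c), (g e).
have := (fa c, fa e, fb c, fb e).
have := (gc' a, gc' b, ge a, ge b).
move=> [[[? ?] ?] ?] [[[? ?] ?] ?].
have /andP[? ?] := fg a; have /andP[? ?] := fg b.
have /andP[? ?] := fg c; have /andP[? ?] := fg e.
by split; rewrite ?ler_norml //; apply/andP; split; lra.
Qed.

End TorusFunctions.

(** * Eigenvalue functions of the fiber operators *)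

Section FiberEigenvalues.
Context {R : realType} {d : nat} {Vs As : finType}.
Variable G : graph Vs As.
Variable m : As -> 'rV[R]_d.
Hypothesis G_connected : graph_connected G.
Hypothesis m_form : one_form G m.
Hypothesis m_integral : forall c, is_cycle G c ->
  exists n : 'rV[int]_d, flux m c = map_mx intr n.
Implicit Types (psi : As -> R) (theta : 'rV[R]_d) (q : Vs -> R).

(** The form m is only gauge equivalent to an integral one, so the fiber operators
    themselves need not be periodic in theta: translation by 2 pi k acts as a
    gauge transformation.  Since u does not depend on psi, the same transformation
    serves the two terms of the perturbation. *)
Lemma phase_periodic (k : 'rV[int]_d) : exists u : Vs -> R[i],
  (forall v, `|u v| = 1) /\
  forall psi theta e, phase m psi (theta + 2 * pi *: map_mx intr k) e =
    u (src G e) * phase m psi theta e * (u (tgt G e))^*%C.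
Proof.
have [g mg] := integral_flux_gauge G_connected m_integral.
exists (fun v => expi (- dotp (g v) (2 * pi *: map_mx intr k))).
split=> [v|psi theta e]; first exact: norm_expi.
rewrite -expiN opprK /phase dotpDr addrA [LHS]expiD; have [n mn] := mg e.
set K := 2 * pi *: _.
have -> : expi (dotp (m e) K) = expi (- dotp (g (src G e)) K) *
    expi (dotp (g (tgt G e)) K) :> R[i].
  by rewrite mn !dotpDl dotpNl expiD expi_dotp_intr mulr1 expiD mulrC.
by rewrite mulrCA mulrA.
Qed.

Lemma schroedinger_periodic psi q n : lattice_periodic
  (fun theta => eigenvalue_nth (fiber_schroedinger G m psi q theta) n).
Proof.
move=> theta k; have [u [u1 uE]] := phase_periodic k.
rewrite /= !eigenvalue_nthE !op_mx_schroedinger.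
by rewrite (@hopping_gauge _ _ _ _ _ (phase m psi theta) _ u).
Qed.

Lemma perturbation_periodic psi n : lattice_periodic
  (fun theta => eigenvalue_nth (fiber_perturbation G m psi theta) n).
Proof.
move=> theta k; have [u [u1 uE]] := phase_periodic k.
rewrite /= !eigenvalue_nthE !op_mx_perturbation.
rewrite (@hopping_gauge _ _ _ _ _
  (fun e => phase m psi theta e - phase m (fun=> 0) theta e) _ u) // => e.
by rewrite !uE mulrBr mulrBl.
Qed.

Lemma schroedinger_continuous psi q n : one_form G psi -> (n < #|Vs|)%N ->
  continuous (fun theta => eigenvalue_nth (fiber_schroedinger G m psi q theta) n).
Proof.
move=> hpsi nV; apply: (@phase_dist_continuous _ _ _ m _ 1) => x y.
rewrite mul1r /= !eigenvalue_nthE !op_mx_schroedinger.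
apply: hopping_eigenvalues_dist => //; [exact: phase_hermitian..|] => v.
exact: phaseB_le.
Qed.

Lemma perturbation_continuous psi n : one_form G psi -> (n < #|Vs|)%N ->
  continuous (fun theta => eigenvalue_nth (fiber_perturbation G m psi theta) n).
Proof.
move=> hpsi nV; apply: (@phase_dist_continuous _ _ _ m _ 2) => x y.
rewrite /= !eigenvalue_nthE !op_mx_perturbation.
have h0 := @zero_form R _ _ G.
apply: hopping_eigenvalues_dist => //; [exact: phaseB_hermitian..|] => v.
rewrite mulr_natl mulr2n rmorphD /=.
apply: le_trans _ 
  (lerD (phaseB_le G m psi x y v) (phaseB_le G m (fun=> 0) x y v)).
rewrite -big_split /=; apply: ler_sum => e _.
apply: le_trans (ler_normB _ _); rewrite le_eqVlt; apply/orP; left.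
by apply/eqP; congr `|_|; ring.
Qed.

(** The magnetic operator is the nonmagnetic one plus the perturbation, whose form
    lies between its extreme eigenvalues times |x|^2; apply Weyl's inequality in
    both directions. *)
Lemma schroedinger_perturbation psi q theta n :
  one_form G psi -> (n < #|Vs|)%N ->
  eigenvalue_nth (fiber_perturbation G m psi theta) 0 <=
  eigenvalue_nth (fiber_schroedinger G m psi q theta) n -
  eigenvalue_nth (fiber_schroedinger G m (fun=> 0) q theta) n <=
  eigenvalue_nth (fiber_perturbation G m psi theta) #|Vs|.-1.
Proof.
move=> hpsi nV; have h0 := @zero_form R _ _ G.
rewrite /= !eigenvalue_nthE op_mx_perturbation.
rewrite !op_mx_schroedinger; set X := hopping G (fun=> 0) _.
have hX : X \is hermsymmx by exact/hopping_hermitian/phaseB_hermitian.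
set qq := (fun v => _ + q v).
have hA psi' : one_form G psi' -> hopping G qq (phase m psi' theta) \is hermsymmx.
  by move=> ?; exact/hopping_hermitian/phase_hermitian.
have AX := hopping_split G qq (phase m psi theta) (phase m (fun=> 0) theta).
apply/andP; split.
  rewrite lerBrDl -lerBrDr.
  apply: (weyl (hA _ h0) (hA _ hpsi) nV) => x.
  rewrite AX qformD -/X rmorphN mulNr -addrA lerDl subr_ge0.
  exact: qform_ge_first.
rewrite lerBlDl; apply: (weyl (hA _ hpsi) (hA _ h0) nV) => x.
by rewrite AX qformD -/X lerD2l qform_le_last.
Qed.

(** The row sums of the perturbation consist of the terms
    |exp(i psi e) - 1| = 2 |sin (psi e / 2)|, since the common phase of the
    quasimomentum has modulus 1. *)
Lemma perturbation_bounded psi theta n : one_form G psi -> (n < #|Vs|)%N ->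
  `|eigenvalue_nth (fiber_perturbation G m psi theta) n| <= C_const G psi.
Proof.
move=> hpsi nV; have h0 := @zero_form R _ _ G.
rewrite /= !eigenvalue_nthE op_mx_perturbation.
have hw := @phaseB_hermitian _ _ _ _ G m m_form psi theta (fun=> 0) theta hpsi h0.
apply: mx_eigenvalues_bounded => //; first exact: hopping_hermitian.
move=> x; apply: qform_hopping_le => // v.
under eq_bigr => e _ do rewrite norm_expiB opprD addrACA subrr addr0 subr0.
rewrite -rmorph_sum /= lecR -mulr_sumr ler_wpM2l //.
apply: le_trans (le_bigmax _ _ v); rewrite big_mkcondr /=.
apply: ler_sum => e _; rewrite inE; case: eqP => //= ->.
by rewrite mul0r sin0 normr0.
Qed.

End FiberEigenvalues.

(** * Comparison of the bands *)

(** The case distinction in the definition disappears: off both supports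
    phi + <m, theta0> vanishes, and on the chosen edges and their inverses it
    vanishes by the choice of theta0. *)
Lemma tilde_form_shift (R : realType) (d : nat) (Vs As : finType)
    (G : graph Vs As) (m : As -> 'rV[R]_d) (phi : As -> R) (es : 'I_d -> As)
    (theta0 : 'rV[R]_d) :
  one_form G m -> one_form G phi ->
  (forall s, phi (es s) + dotp (m (es s)) theta0 = 0) ->
  tilde_form G m phi es theta0 = fun e => phi e + dotp (m e) theta0.
Proof.
move=> m_form phi_form h0; apply/funext => e; rewrite /tilde_form.
case: ifPn => //; rewrite negb_and negbK => /orP[|/existsP[s /orP[]/eqP->]].
- rewrite !inE negb_or !negbK => /andP[/eqP-> /eqP->].
  by rewrite dotp0l addr0.
- by rewrite h0.
- by rewrite phi_form m_form dotpNl -opprD h0 oppr0.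
Qed.

(** Adding <m, theta0> to phi translates the quasimomentum by theta0. *)
Lemma band_shift (R : realType) (d : nat) (Vs As : finType) (G : graph Vs As)
    (m : As -> 'rV[R]_d) (phi : As -> R) (theta0 : 'rV[R]_d) (Q : Vs -> R) n :
  band G m phi Q n = band G m (fun e => phi e + dotp (m e) theta0) Q n.
Proof.
have shift t : fiber_schroedinger G m (fun e => phi e + dotp (m e) theta0) Q t =
    fiber_schroedinger G m phi Q (theta0 + t).
  apply/funext => f; apply/funext => v.
  rewrite /fiber_schroedinger /fiber_laplacian.
  by under [in RHS]eq_bigr do rewrite dotpDr addrA.
apply/seteqP; split=> _ [t _ <-].
  by exists (t - theta0); [by []|rewrite shift addrC subrK].
by exists (theta0 + t); [by []|rewrite shift].
Qed.

Lemma fundamental_card_gt0 (R : realType) (d : nat) (V A : Type)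
    (P : periodic_graph R d V A) (Vs As : finType)
    (G : fundamental_graph P Vs As) : (0 < #|Vs|)%N.
Proof.
rewrite lt0n; apply/negP => /eqP Vs0; apply: (pg_infinite P).
suff -> : [set: V] = set0 by exact: finite_set0.
by apply/seteqP; split=> // v _; have := card0_eq Vs0 (vproj G v).
Qed.

Theorem theorem2p6 (R : realType) (d : nat) (V A : Type)
    (P : periodic_graph R d V A)
    (Vs As : finType) (G : fundamental_graph P Vs As)
    (alpha : A -> R) (halpha : magnetic_potential P alpha)
    (Q : V -> R) (hQ : electric_potential P Q)
    (m : As -> 'rV[R]_d)
    (hm : minimal_form (forms_with_flux G (coordinate_form G)) m)
    (phi : As -> R)
    (hphi : minimal_form (forms_with_flux_mod2pi G (magnetic_form G alpha)) phi)
    (es : 'I_d -> As)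
    (hes : forall s, es s \in supp m)
    (hes_free : row_free (\matrix_(s < d) m (es s)))
    (theta0 : 'rV[R]_d)
    (htheta0 : forall s, phi (es s) + dotp (m (es s)) theta0 = 0) :
  let phit := tilde_form G m phi es theta0 in
  let X := fiber_perturbation G m phit in
  let Qs := quotient_potential G Q in
  exists Lambda1 Lambdanu : R,
  [/\ is_min_of (fun theta => eigenvalue_nth (X theta) 0) Lambda1,
      is_max_of (fun theta => eigenvalue_nth (X theta) #|Vs|.-1) Lambdanu,
      forall n : 'I_#|Vs|, exists la_m la_p l0_m l0_p : R,
        [/\ band G m phi Qs n = `[la_m, la_p]%classic /\
            band G m (fun=> 0) Qs n = `[l0_m, l0_p]%classic,
            Lambda1 <= la_m - l0_m <= Lambdanu,
            Lambda1 <= la_p - l0_p <= Lambdanu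
          & `|(la_p - la_m) - (l0_p - l0_m)| <= Lambdanu - Lambda1],
      Num.max `|Lambda1| `|Lambdanu| <= C_const G phit
    & Lambdanu - Lambda1 <= 2 * C_const G phit].
Proof.
move=> phit X Qs.
have [[m_form m_flux] _] := hm; have [[phi_form _] _] := hphi.
have G_conn := fundamental_connected G.
have m_integral c : is_cycle G c ->
    exists n : 'rV[int]_d, flux m c = map_mx intr n.
  by move=> cc; rewrite m_flux //; exact: coordinate_form_flux.
have phitE : phit = fun e => phi e + dotp (m e) theta0.
  exact: tilde_form_shift.
have phit_form : one_form G phit.
  by move=> e; rewrite phitE phi_form m_form dotpNl opprD.
have Vs_gt0 : (0 < #|Vs|)%N by exact: fundamental_card_gt0 G.
have V_last : (#|Vs|.-1 < #|Vs|)%N by rewrite prednK.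
have [t1 [_ [X1 _ _]]] := periodic_extrema
  (perturbation_continuous m_form phit_form Vs_gt0)
  (perturbation_periodic G_conn m_integral phit 0).
have [_ [tnu [_ Xnu _]]] := periodic_extrema
  (perturbation_continuous m_form phit_form V_last)
  (perturbation_periodic G_conn m_integral phit #|Vs|.-1).
set L1 := eigenvalue_nth _ 0 in X1; set Lnu := eigenvalue_nth _ _ in Xnu.
have L1C : `|L1| <= C_const G phit by exact: perturbation_bounded.
have LnuC : `|Lnu| <= C_const G phit by exact: perturbation_bounded.
exists L1, Lnu; split.
- by split; [exists t1|].
- by split; [exists tnu|].
- move=> n; rewrite (band_shift G m phi theta0) -phitE.
  apply: periodic_ranges_close.
  + exact: schroedinger_continuous.
  + exact: schroedinger_periodic.
  + exact: (schroedinger_continuous m_form (q := Qs) (zero_form G) (ltn_ord n)).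
  + exact: schroedinger_periodic.
  move=> t; have /andP[lo hi] :=
    schroedinger_perturbation m_form Qs t phit_form (ltn_ord n).
  by rewrite (le_trans (X1 t) lo) (le_trans hi (Xnu t)).
- by rewrite ge_max L1C.
- by move: L1C LnuC; rewrite !ler_norml => /andP[? ?] /andP[? ?]; lra.
Qed.
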